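(* There exist constants $c, C > 0$ and a sequence of finite point sets $X_1, X_2, \dots \subset \mathbb{R}^2$, each in general position, with $N_j = |X_j| \to \infty$, such that for every $j$ we have $\mathrm{CON}(X_j) \le C N_j^{1/3}$ and $\mathrm{CUT}_K(X_j) \ge c \frac{N_j}{K}$ for every integer $K \ge 1$.
   Context: General position means no three points are collinear. A convex curve is the boundary of a compact convex set with nonempty interior in the plane. The convex number $\mathrm{CON}(X)$ is the maximum of $|X \cap \gamma|$ over all convex curves $\gamma$. A simple arrangement of $K$ lines is a set of $K$ lines, no two parallel and no three through a common point; its cells are the connected components of the complement of the union of the lines. The cutting number is $\mathrm{CUT}_K(X) = \min_{\mathcal{A}_K} \max_{\text{cells } c} |X \cap c|$, the minimum over simple arrangements $\mathcal{A}_K$ of $K$ lines (as implicit in the paper, the lines are taken to avoid the points of $X$, so every point of $X$ lies in some cell). *)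

(* Defs.v *)
From HB Require Import structures.
From mathcomp Require Import all_boot all_order all_algebra finmap.
From mathcomp Require Import all_classical all_reals all_analysis.

Set Implicit Arguments.
Unset Strict Implicit.
Unset Printing Implicit Defensive.

Import Order.TTheory GRing.Theory Num.Theory.
Import numFieldNormedType.Exports.

Local Open Scope classical_set_scope.
Local Open Scope ring_scope.

Section plane.
Context {R : realType}.

Notation plane := 'rV[R]_2.

Definition is_line (l : set plane) : Prop :=
  exists a b d : R, (a != 0 \/ b != 0) /\
    l = [set p : plane | a * p 0 0 + b * p 0 1 = d].

Definition collinear (p q r : plane) : Prop :=
  exists l : set plane, [/\ is_line l, l p, l q & l r].

Definition general_position (X : {fset plane}) : Prop :=
  forall p q r : plane, p \in X -> q \in X -> r \in X ->
    p != q -> q != r -> p != r -> ~ collinear p q r.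

Definition npoints (X : {fset plane}) (A : set plane) : nat :=
  #|` [fset x in X | x \in A]%fset |.

Definition boundary (A : set plane) : set plane := closure A `\` interior A.

Definition convex_curve (g : set plane) : Prop :=
  exists A : set plane,
    [/\ compact A, convex_set A, interior A !=set0 & g = boundary A].

(* The values of [npoints X] are naturals bounded by #|` X|, so the suprema
   and infima below, taken over nonempty families, are attained: they are the
   maxima and minima. (Every finite X is avoided by some simple arrangement of
   K lines, so the family in [CUT] is never empty.) *)
Definition CON (X : {fset plane}) : R :=
  sup [set (npoints X g)%:R | g in convex_curve].

Definition parallel (l m : set plane) : Prop := l = m \/ l `&` m = set0.

Definition simple_arrangement (K : nat) (L : set (set plane)) : Prop :=
  [/\ (L #= `I_K)%card,
      forall l, L l -> is_line l,
      forall l m, L l -> L m -> l <> m -> ~ parallel l m &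
      forall l m n, L l -> L m -> L n -> l <> m -> m <> n -> l <> n ->
        l `&` m `&` n = set0].

Definition arrangement_complement (L : set (set plane)) : set plane :=
  ~` \bigcup_(l in L) l.

Definition cells (L : set (set plane)) : set (set plane) :=
  connected_component (arrangement_complement L) @` arrangement_complement L.

Definition avoids (L : set (set plane)) (X : {fset plane}) : Prop :=
  forall p, p \in X -> arrangement_complement L p.

Definition max_cell (X : {fset plane}) (L : set (set plane)) : R :=
  sup [set (npoints X c)%:R | c in cells L].

Definition CUT (K : nat) (X : {fset plane}) : R :=
  inf [set max_cell X L | L in
        [set L | simple_arrangement K L /\ avoids L X]].

End plane.

(* Main.v *)
(** A cup (cap) is a sequence of points whose successive slopes increase
    (decrease).  We take N = m^3 points with abscissae 0, ..., N - 1, where n is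
    written in base m as a three-digit number, and with rapidly growing heights,
    such that the slope from a to b > a lies between W^(key a b) / (2 m^3) and
    3 W^(key a b), where W = 6 m^3 + 1 and 0 <= key < 3m: the larger key gives
    the larger slope.  The key is ordered first by the leading
    digit at which a and b differ (a higher digit gives a larger key), then by
    that digit of b.

    Keys increase strictly along a cup and decrease strictly along a cap, so
    both have at most 3m + 1 points; and a point of a convex curve which is the
    middle of a cup and also the middle of a cap of points of the curve would be
    interior.  Hence CON <= 2 (3m + 1) <= 8 N^(1/3).

    A triple a < b < c is a cap exactly when b and c first differ in a lower
    digit than a and b do, and there are only three digits.  If a line has a and
    c below it and b above it, then a, b, c is a cap; this forces the points,
    read from left to right, to cross the line at most 8 times.  So K lines cut
    the sequence of points into at most 8K + 1 <= 9K blocks of consecutive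
    points, each block is contained in one cell, and some block has at least
    N / (9K) points. *)
Require Import Defs.
From HB Require Import structures.
From mathcomp Require Import all_boot all_order all_algebra finmap.
From mathcomp Require Import all_classical all_reals all_analysis.
From mathcomp Require Import zify ring lra.

Set Implicit Arguments.
Unset Strict Implicit.
Unset Printing Implicit Defensive.

(** * Digits, levels, keys and heights *)

Definition base m := (6 * m ^ 3).+1.

Definition height m n :=
  base m ^ (2 * m + n %/ m ^ 2) + base m ^ (m + n %/ m %% m) + base m ^ (n %% m).

(* For [a < b < m ^ 3], the position (0 for the last) of the leading base-[m]
   digit at which [a] and [b] differ. *)
Definition level m a b := (a %/ m < b %/ m) + (a %/ m ^ 2 < b %/ m ^ 2).

(** For [a < b], the exponent of the largest term of [height m b] that differs from the
    corresponding term of [height m a]. *)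
Definition key m a b :=
  if a %/ m ^ 2 < b %/ m ^ 2 then 2 * m + b %/ m ^ 2
  else if a %/ m < b %/ m then m + b %/ m %% m else b %% m.

Lemma level_le2 m a b : level m a b <= 2.
Proof. by rewrite /level; do 2!case: (_ < _). Qed.

Lemma level_mono m a b c d : a <= b -> c <= d -> level m b c <= level m a d.
Proof.
move=> ab cd; rewrite /level leq_add ?leq_b1//.
- by case: ltnP => //= bc; rewrite (leq_ltn_trans (leq_div2r m ab))// (leq_trans bc) ?leq_div2r.
- case: ltnP => //= bc.
  by rewrite (leq_ltn_trans (leq_div2r _ ab))// (leq_trans bc) ?leq_div2r.
Qed.

Lemma divn_sq m n : n %/ m ^ 2 = n %/ m %/ m.
Proof. by rewrite -divnMA mulnn. Qed.

Lemma key_lt m a b : 0 < m -> b < m ^ 3 -> key m a b < 3 * m.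
Proof.
move=> m0 b3; rewrite /key.
have : b %/ m ^ 2 < m by rewrite ltn_divLR ?expn_gt0 ?m0// -expnS.
have := ltn_pmod b m0; have := ltn_pmod (b %/ m) m0.
move: (b %/ m ^ 2) (b %/ m %% m) (b %% m) => u v w.
by case: ifP => _; [|case: ifP => _]; lia.
Qed.

(** Keys of level [i] start at [i * m], and those of lower levels stay below that. At equal levels,
    [b] and [c] agree in the higher digits, so the deciding digit of [c] exceeds that of [b]. *)
Lemma key_incr m a b c : 0 < m -> a < b -> b < c ->
  level m a b <= level m b c -> key m a b < key m b c.
Proof.
move=> m0 ab bc; rewrite /level /key.
have := ltn_pmod b m0; have := ltn_pmod (b %/ m) m0.
have := leq_div2r m (ltnW ab); have := leq_div2r m (ltnW bc).
have := leq_div2r (m ^ 2) (ltnW ab); have := leq_div2r (m ^ 2) (ltnW bc).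
have := @leq_div2r m (b %/ m) (a %/ m); rewrite !divn_sq.
have := divn_eq b m; have := divn_eq c m.
have := divn_eq (b %/ m) m; have := divn_eq (c %/ m) m.
move: (a %/ m) (b %/ m) (c %/ m) (b %% m) (c %% m) => a1 b1 c1 rb rc.
move: (a1 %/ m) (b1 %/ m) (c1 %/ m) (b1 %% m) (c1 %% m) => a2 b2 c2 rb1 rc1.
move=> Ec1 Eb1 Ec Eb ba2 bc2 ab2 bc1 ab1 Mb1 Mb.
case: (ltnP b2 c2) => [b2c2|c2b2].
  clear Ec1 Eb1 Ec Eb.
  by case: (ltnP a2 b2); case: (ltnP b1 c1); case: (ltnP a1 b1) => //= *; lia.
have E2 : c2 = b2 by lia.
subst c2; case: (ltnP b1 c1) => [b1c1|c1b1].
  have rr : rb1 < rc1 by lia.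
  clear Ec1 Eb1 Ec Eb.
  by case: (ltnP a2 b2) => //=; case: (ltnP a1 b1) => //= *; lia.
have E1 : c1 = b1 by lia.
subst c1; have rr : rb < rc by lia.
by clear Eb1 Ec Eb; case: (ltnP a1 b1) => //=; case: (ltnP a2 b2) => //= *; lia.
Qed.

Lemma key_decr m a b c : 0 < m -> level m b c < level m a b ->
  key m b c < key m a b.
Proof.
move=> m0; rewrite /level /key.
have := ltn_pmod c m0; have := ltn_pmod (c %/ m) m0.
have := @leq_div2r m (b %/ m) (a %/ m); have := @leq_div2r m (c %/ m) (b %/ m).
rewrite -!divn_sq.
move: (a %/ m ^ 2) (b %/ m ^ 2) (c %/ m ^ 2) => a2 b2 c2.
move: (b %/ m %% m) (c %/ m %% m) (b %% m) (c %% m) => rb1 rc1 rb rc.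
move: (a %/ m) (b %/ m) (c %/ m) => a1 b1 c1.
by case: (ltnP a2 b2); case: (ltnP b2 c2); case: (ltnP a1 b1);
  case: (ltnP b1 c1) => //= *; lia.
Qed.

(** Terms above the deciding digit cancel, and all others are small against [base m ^ key m a b].
    Doubling expresses a lower bound by one half inside [nat]. *)
Lemma height_bounds m a b : 0 < m -> a < b ->
  2 * height m a + base m ^ key m a b <= 2 * height m b /\
  height m b <= height m a + 3 * base m ^ key m a b.
Proof.
move=> m0 ab; rewrite /height /key.
(* At most three terms of [a] are lost, each at most a seventh of [base m ^ key m a b], so more than
   half of it remains. *)
have W7 : 7 <= base m by rewrite /base; have := expn_gt0 m 3; rewrite m0 /=; lia.
have W1 : 1 < base m by exact: leq_trans W7.
have mono x y : x <= y -> base m ^ x <= base m ^ y by move=> xy; rewrite leq_exp2l.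
have mono7 x y : x < y -> 7 * base m ^ x <= base m ^ y.
  by move=> xy; apply: leq_trans (mono _ _ xy); rewrite expnS leq_mul2r W7 orbT.
have := ltn_pmod b m0; have := ltn_pmod (b %/ m) m0.
have := ltn_pmod a m0; have := ltn_pmod (a %/ m) m0.
have := leq_div2r m (ltnW ab).
have := divn_eq b m; have := divn_eq a m.
have := divn_eq (b %/ m) m; have := divn_eq (a %/ m) m.
have := leq_div2r (m ^ 2) (ltnW ab).
rewrite !divn_sq.
move: (a %% m) (b %% m) => ra rb.
move: (a %/ m) (b %/ m) => a1 b1.
move: (a1 %/ m) (b1 %/ m) (a1 %% m) (b1 %% m) => a2 b2 ra1 rb1.
move: (base m) mono mono7 => W mono mono7 ab2 Ea1 Eb1 Ea Eb ab1 Ma1 Ma Mb1 Mb.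
case: ltnP => c2.
  clear Ea1 Eb1 Ea Eb.
  have := mono7 (2 * m + a2) (2 * m + b2) ltac:(lia).
  have := mono (m + ra1) (2 * m + a2) ltac:(lia).
  have := mono ra (2 * m + a2) ltac:(lia).
  have := mono (m + rb1) (2 * m + a2) ltac:(lia).
  have := mono rb (2 * m + a2) ltac:(lia); clear; lia.
have E2 : a2 = b2 by clear -c2 ab2; lia.
subst a2; case: ltnP => c1.
  have rr : ra1 < rb1 by clear -c1 Ea1 Eb1; lia.
  have := mono7 (m + ra1) (m + rb1) ltac:(lia).
  have := mono ra (m + ra1) ltac:(lia).
  have := mono rb (m + ra1) ltac:(lia); clear; lia.
have E1 : a1 = b1 by clear -c1 ab1; lia.
have E3 : ra1 = rb1 by clear -Ea1 Eb1 E1; lia.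
subst ra1; have rr : ra < rb by clear -Ea Eb E1 ab; nia.
have := mono7 ra rb ltac:(lia); clear; lia.
Qed.

(** * Chains of bounded keys, and a pigeonhole principle *)

Lemma size_increasing_chain (k : nat -> nat -> nat) M (s : seq nat) :
  sorted ltn s ->
  {in s &, forall a b, a < b -> k a b < M} ->
  {in s & &, forall a b c, a < b -> b < c -> k a b < k b c} ->
  size s <= M.+1.
Proof.
case: s => [//|a [//|b s]] ss kM kI.
(* Every further element raises the key by at least one, so the first key plus the number of
   elements still to come stays below [M]. *)
suff : k a b + size s < M by rewrite /=; lia.
elim: s a b ss kM kI => [|c s IHs] a b /=.
  by move=> /andP[ab _] /(_ a b); rewrite !inE !eqxx orbT addn0 => /(_ isT isT ab).
move=> /and3P[ab bc cs] kM kI.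
have kabc : k a b < k b c by apply: kI; rewrite ?inE ?eqxx ?orbT.
suff : k b c + size s < M by lia.
apply: IHs; first by rewrite /= bc.
- by move=> x y xs ys; apply: kM; rewrite inE ?xs ?ys orbT.
- by move=> x y z xs ys zs; apply: kI; rewrite inE ?xs ?ys ?zs orbT.
Qed.

Lemma size_decreasing_chain (k : nat -> nat -> nat) M (s : seq nat) :
  sorted ltn s ->
  {in s &, forall a b, a < b -> k a b < M} ->
  {in s & &, forall a b c, a < b -> b < c -> k b c < k a b} ->
  size s <= M.+1.
Proof.
move=> ss kM kI; apply: (@size_increasing_chain (fun a b => M.-1 - k a b)) => //.
- by move=> a b sa sb ab; have := kM a b sa sb ab; lia.
- move=> a b c sa sb sc ab bc.
  by have := kI a b c sa sb sc ab bc; have := kM a b sa sb ab; lia.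
Qed.

(** Averaging: the fibres of [f] have total size [N], so they cannot all be smaller than [N / V]. *)
Lemma pigeonhole_count V N (f : nat -> nat) : 0 < V ->
  (forall n, n < N -> f n < V) ->
  exists v : nat, N <= V * count (fun n => f n == v) (iota 0 N).
Proof.
move=> V0 fV.
have tot : \sum_(v < V) count (fun n => f n == v) (iota 0 N) = N.
  under eq_bigr => v _ do rewrite -sum1_count big_mkcond.
  rewrite exchange_big /= -[RHS](size_iota 0) -sum1_size.
  rewrite big_seq [RHS]big_seq; apply: eq_bigr => n; rewrite mem_iota => /andP[_ nN].
  by rewrite -big_mkcond /= (big_pred1 (Ordinal (fV n nN))).
have [/existsP[v Hv]|] := boolP [exists v : 'I_V,
    N <= V * count (fun n => f n == v) (iota 0 N)]; first by exists (v : nat).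
rewrite negb_exists => /forallP small.
suff : V * N < V * N by rewrite ltnn.
rewrite -{1}tot big_distrr /= -[X in _ < X * _]card_ord -sum_nat_const.
case: V V0 {fV tot} small => // V _ small.
rewrite big_ord_recl [ltnRHS]big_ord_recl -addSn leq_add//.
  by rewrite ltnNge small.
by apply: leq_sum => i _; rewrite ltnW// ltnNge small.
Qed.

(** * Few sign changes along the sequence of points *)

Section sign_changes.
Context (m N : nat) (s : nat -> bool).
Context (cap : forall a b c, a < b -> b < c -> c < N ->
  ~~ s a -> s b -> ~~ s c -> level m b c < level m a b).

(** For rises [x < y < z], the triple [x], [x.+1], [z] is a cap, and the unit step at [y] lies
    between [x.+1] and [z]; so the level at [y] is below the level at [x]. Five rises would give
    three drops from a level of at most 2. *)
Lemma count_rises n : n < N -> count (fun i => ~~ s i && s i.+1) (iota 0 n) <= 4.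
Proof.
move=> nN; rewrite -size_filter leqNgt; apply/negP.
have : sorted ltn [seq i <- iota 0 n | ~~ s i && s i.+1].
  exact/(sorted_filter ltn_trans)/iota_ltn_sorted.
have : all (fun i => [&& i < n, ~~ s i & s i.+1]) [seq i <- iota 0 n | ~~ s i && s i.+1].
  by apply/allP => i; rewrite mem_filter mem_iota add0n /= => /andP[-> ->].
case: seq.filter => [//|a [//|b [//|c [//|d [//|e t]]]]] /=.
move=> /and5P[/and3P[an as0 as1] /and3P[bn bs0 bs1] /and3P[cn cs0 cs1]].
move=> /and3P[dn ds0 ds1] /andP[/and3P[en es0 es1] _] /and5P[ab bc cd de _] _.
have step x y z : ~~ s x -> s x.+1 -> ~~ s y -> s y.+1 -> ~~ s z ->
    x < y -> y < z -> z < n -> level m y y.+1 < level m x x.+1.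
  move=> xs0 xs1 ys0 ys1 zs xy yz zn.
  have {}xy : x.+1 < y by rewrite ltn_neqAle xy andbT; apply: contraNneq ys0 => <-.
  have {}yz : y.+1 < z by rewrite ltn_neqAle yz andbT; apply: contraNneq zs => <-.
  apply: (leq_ltn_trans _ (cap (ltnSn x) (ltn_trans xy (ltnW yz)) (ltn_trans zn nN) xs0 xs1 zs)).
  exact: level_mono (ltnW xy) (ltnW yz).
have := step a b c as0 as1 bs0 bs1 cs0 ab bc cn.
have := step b c d bs0 bs1 cs0 cs1 ds0 bc cd dn.
have := step c d e cs0 cs1 ds0 ds1 es0 cd de en.
have := level_le2 m a a.+1; clear; lia.
Qed.

(** Here the decreasing levels are those of the gaps between successive falls: for falls
    [x < y < z], the cap is [x.+1], [y], [z.+1]. *)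
Lemma count_falls n : n < N -> count (fun i => s i && ~~ s i.+1) (iota 0 n) <= 4.
Proof.
move=> nN; rewrite -size_filter leqNgt; apply/negP.
have : sorted ltn [seq i <- iota 0 n | s i && ~~ s i.+1].
  exact/(sorted_filter ltn_trans)/iota_ltn_sorted.
have : all (fun i => [&& i < n, s i & ~~ s i.+1]) [seq i <- iota 0 n | s i && ~~ s i.+1].
  by apply/allP => i; rewrite mem_filter mem_iota add0n /= => /andP[-> ->].
case: seq.filter => [//|a [//|b [//|c [//|d [//|e t]]]]] /=.
move=> /and5P[/and3P[an as0 as1] /and3P[bn bs0 bs1] /and3P[cn cs0 cs1]].
move=> /and3P[dn ds0 ds1] /andP[/and3P[en es0 es1] _] /and5P[ab bc cd de _] _.
have step x y z : ~~ s x.+1 -> s y -> ~~ s y.+1 -> s z -> ~~ s z.+1 ->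
    x < y -> y < z -> z < n -> level m y.+1 z < level m x.+1 y.
  move=> xs1 ys0 ys1 zs0 zs1 xy yz zn.
  have {}xy : x.+1 < y by rewrite ltn_neqAle xy andbT; apply: contraNneq xs1 => ->.
  apply: (leq_ltn_trans _ (cap xy (leqW yz) (leq_ltn_trans zn nN) xs1 ys0 zs1)).
  exact: level_mono (leqnSn y) (leqnSn z).
have := step a b c as1 bs0 bs1 cs0 cs1 ab bc cn.
have := step b c d bs1 cs0 cs1 ds0 ds1 bc cd dn.
have := step c d e cs1 ds0 ds1 es0 es1 cd de en.
have := level_le2 m a.+1 b; clear; lia.
Qed.

Lemma count_sign_changes n : n < N ->
  count (fun i => s i != s i.+1) (iota 0 n) <= 8.
Proof.
move=> nN; apply: leq_trans (leq_add (count_rises nN) (count_falls nN)).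
rewrite -count_predUI; apply: leq_trans (leq_addr _ _).
by apply: sub_count => i /=; case: (s i); case: (s i.+1).
Qed.

End sign_changes.

Lemma sign_change_free (s : nat -> bool) a b : a <= b ->
  count (fun i => s i != s i.+1) (iota 0 a) = count (fun i => s i != s i.+1) (iota 0 b) ->
  s a = s b.
Proof.
move=> ab; rewrite -(subnKC ab) iotaD count_cat add0n => /eqP.
rewrite -[X in X == _]addn0 eqn_add2l eq_sym => /eqP; elim: (b - a) => [|n IHn].
  by rewrite addn0.
rewrite -{1}addn1 iotaD count_cat /= addn0 => /eqP; rewrite addn_eq0 => /andP[/eqP h].
by rewrite eqb0 negbK addnS -(IHn h) => /eqP.
Qed.

Import Order.TTheory GRing.Theory Num.Theory.
Import numFieldNormedType.Exports.

Local Open Scope classical_set_scope.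
Local Open Scope ring_scope.

(** * Orientation of triples, and its sign on the constructed points *)

Section orientation.
Context {R : realType}.
Implicit Types p q r : 'rV[R]_2.

(** Twice the signed area of the triangle: for increasing abscissae, positive on a cup and negative
    on a cap. *)
Definition orient p q r : R :=
  (q 0 0 - p 0 0) * (r 0 1 - q 0 1) - (r 0 0 - q 0 0) * (q 0 1 - p 0 1).

Lemma collinear_orient p q r : collinear p q r -> orient p q r = 0.
Proof.
move=> [l [[a [b [d [ab ->]]]] /= lp lq lr]]; rewrite /orient.
have ea : a * orient p q r = 0.
  rewrite /orient; transitivity ((a * q 0 0 + b * q 0 1 - (a * p 0 0 + b * p 0 1)) *
    (r 0 1 - q 0 1) - (a * r 0 0 + b * r 0 1 - (a * q 0 0 + b * q 0 1)) *
    (q 0 1 - p 0 1)); first by ring.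
  by rewrite lp lq lr !subrr !mul0r subrr.
have eb : b * orient p q r = 0.
  rewrite /orient; transitivity ((a * r 0 0 + b * r 0 1 - (a * q 0 0 + b * q 0 1)) *
    (q 0 0 - p 0 0) - (a * q 0 0 + b * q 0 1 - (a * p 0 0 + b * p 0 1)) *
    (r 0 0 - q 0 0)); first by ring.
  by rewrite lp lq lr !subrr !mul0r subrr.
by case: ab => /mulfI; apply; rewrite mulr0.
Qed.

Definition pt m n : 'rV[R]_2 :=
  \row_(i < 2) (if i == 0 then n else height m n)%:R.

Lemma pt0 m n : pt m n 0 0 = n%:R. Proof. by rewrite mxE. Qed.

Lemma pt1 m n : pt m n 0 1 = (height m n)%:R. Proof. by rewrite mxE. Qed.

Lemma pt_inj m : injective (pt m).
Proof.
by move=> a b /(congr1 (fun p : 'rV[R]_2 => p 0 0)) /eqP; rewrite !pt0 eqr_nat => /eqP.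
Qed.

(** With horizontal gaps [g1], [g2] in [[1, m ^ 3]], rises [D1], [D2] and powers [U], [V], the
    orientation is [g1 * D2 - g2 * D1]. If [V] has the larger key, then [g2 * D1 <= 3 * m ^ 3 * U <
    V / 2 <= g1 * D2], which is what [base] is chosen for; the other case is symmetric. *)
Lemma orient_key m a b c : (0 < m)%N -> (a < b)%N -> (b < c)%N -> (c < m ^ 3)%N ->
  ((key m a b < key m b c)%N -> 0 < orient (pt m a) (pt m b) (pt m c)) /\
  ((key m b c < key m a b)%N -> orient (pt m a) (pt m b) (pt m c) < 0).
Proof.
move=> m0 ab bc c3; rewrite /orient !pt0 !pt1.
have [] := height_bounds m0 ab; have [] := height_bounds m0 bc.
have W1 : (0 < base m)%N by [].
have Wlt x y : (x < y)%N -> (6 * m ^ 3 * base m ^ x + base m ^ x <= base m ^ y)%N.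
  move=> xy; apply: leq_trans (leq_pexp2l W1 xy).
  by rewrite (expnS (base m)) [X in (_ <= X * _)%N]/base mulSn [leqRHS]addnC.
move: (height m a) (height m b) (height m c) => ya yb yc.
move: (key m a b) (key m b c) => u v.
have Wu : (0 < base m ^ u)%N by rewrite expn_gt0.
have Wv : (0 < base m ^ v)%N by rewrite expn_gt0.
have := Wlt u v; have := Wlt v u.
move: (base m ^ u)%N (base m ^ v)%N Wu Wv => U V Wu Wv vu uv.
move=> h1 h2 h3 h4.
have {}h1 : 2 * yb%:R + V%:R <= 2 * yc%:R :> R by rewrite -!natrM -natrD ler_nat.
have {}h2 : yc%:R <= yb%:R + 3 * V%:R :> R by rewrite -natrM -natrD ler_nat.
have {}h3 : 2 * ya%:R + U%:R <= 2 * yb%:R :> R by rewrite -!natrM -natrD ler_nat.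
have {}h4 : yb%:R <= ya%:R + 3 * U%:R :> R by rewrite -natrM -natrD ler_nat.
have : (b - a)%:R <= (m ^ 3)%:R :> R by rewrite ler_nat; lia.
have : (c - b)%:R <= (m ^ 3)%:R :> R by rewrite ler_nat; lia.
have : 1 <= (b - a)%:R :> R by rewrite ler1n; lia.
have : 1 <= (c - b)%:R :> R by rewrite ler1n; lia.
have U0 : 0 < U%:R :> R by rewrite ltr0n.
have V0 : 0 < V%:R :> R by rewrite ltr0n.
rewrite !natrB ?(ltnW ab) ?(ltnW bc)//.
move: (b%:R - a%:R) (c%:R - b%:R) => g1 g2 g2ge g1ge g2le g1le.
have d1 : U%:R <= 2 * (yb%:R - ya%:R) :> R by lra.
have d2 : V%:R <= 2 * (yc%:R - yb%:R) :> R by lra.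
have d1' : yb%:R - ya%:R <= 3 * U%:R :> R by lra.
have d2' : yc%:R - yb%:R <= 3 * V%:R :> R by lra.
move: (yb%:R - ya%:R) (yc%:R - yb%:R) d1 d2 d1' d2' => D1 D2 d1 d2 d1' d2'.
split=> [/uv|/vu] hW.
- have {}hW : 6 * (m ^ 3)%:R * U%:R + U%:R <= V%:R :> R.
    by rewrite -!natrM -natrD ler_nat.
  have : 2 * (g2 * D1) <= 6 * (m ^ 3)%:R * U%:R.
    have : g2 * D1 <= (m ^ 3)%:R * (3 * U%:R) by apply: ler_pM => //; lra.
    lra.
  have : D2 <= g1 * D2 by rewrite ler_peMl//; lra.
  lra.
- have {}hW : 6 * (m ^ 3)%:R * V%:R + V%:R <= U%:R :> R.
    by rewrite -!natrM -natrD ler_nat.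
  have : 2 * (g1 * D2) <= 6 * (m ^ 3)%:R * V%:R.
    have : g1 * D2 <= (m ^ 3)%:R * (3 * V%:R) by apply: ler_pM => //; lra.
    lra.
  have : D1 <= g2 * D1 by rewrite ler_peMl//; lra.
  lra.
Qed.

Lemma orient_level m a b c : (0 < m)%N -> (a < b)%N -> (b < c)%N -> (c < m ^ 3)%N ->
  if (level m a b <= level m b c)%N
  then 0 < orient (pt m a) (pt m b) (pt m c)
  else orient (pt m a) (pt m b) (pt m c) < 0.
Proof.
move=> m0 ab bc c3; have [pos neg] := orient_key m0 ab bc c3.
by case: leqP => lev; [apply: pos; exact: key_incr|apply: neg; exact: key_decr].
Qed.

End orientation.

(** * Interior points of planar convex sets *)

Section convexity.
Context {R : realType}.
Implicit Types (p q r : 'rV[R]_2) (A : set 'rV[R]_2).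

Lemma ord2_ind (P : 'I_2 -> Prop) : P 0 -> P 1 -> forall i, P i.
Proof.
by move=> P0 P1 [[|[|//]] i2]; [move: P0|move: P1]; congr P; apply: val_inj.
Qed.

Lemma convex_set_weights A p q r (a b : R) : convex_set A -> A p -> A q ->
  0 <= a -> 0 <= b -> 0 < a + b ->
  (forall i, (a + b) * r 0 i = a * p 0 i + b * q 0 i) -> A r.
Proof.
move=> cA Ap Aq a0 b0 ab0 rE.
have t0 : 0 <= a / (a + b) by rewrite divr_ge0// ltW.
have t1 : a / (a + b) <= 1 by rewrite ler_pdivrMr// mul1r lerDl.
have := cA p q (Itv01 t0 t1) (mem_set Ap) (mem_set Aq); rewrite inE.
congr A; apply/rowP => i; rewrite !mxE /= /unstable.onem.
apply: (mulfI (lt0r_neq0 ab0)); rewrite rE.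
by field; exact: lt0r_neq0.
Qed.

Lemma near_affine_gt0 p (a b c : R) : 0 < a * p 0 0 + b * p 0 1 + c ->
  nbhs p [set q : 'rV[R]_2 | 0 < a * q 0 0 + b * q 0 1 + c].
Proof.
suff cvp : (fun q : 'rV[R]_2 => a * q 0 0 + b * q 0 1 + c) @ p -->
    a * p 0 0 + b * p 0 1 + c by move=> h; exact: (cvgr_gt _ cvp _ h).
have coord i : (fun q : 'rV[R]_2 => q 0 i) @ p --> p 0 i by exact: coord_continuous.
exact: (cvgD (cvgD (cvgM (cvg_cst a) (coord 0)) (cvgM (cvg_cst b) (coord 1))) (cvg_cst c)).
Qed.

Lemma vertical_chord A p a b : convex_set A -> A a -> A b ->
  a 0 0 < p 0 0 -> p 0 0 < b 0 0 ->
  exists2 u, A u & u 0 0 = p 0 0 /\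
    (b 0 0 - a 0 0) * (u 0 1 - p 0 1) = orient a p b.
Proof.
move=> cA Aa Ab ap pb.
have ab : 0 < b 0 0 - a 0 0 by lra.
pose u : 'rV[R]_2 := \row_i (((b 0 0 - p 0 0) * a 0 i + (p 0 0 - a 0 0) * b 0 i) /
  (b 0 0 - a 0 0)).
exists u; last by rewrite !mxE /orient; split; field; lra.
apply: (@convex_set_weights A a b u (b 0 0 - p 0 0) (p 0 0 - a 0 0)) => //; try lra.
by move=> i; rewrite mxE; field; lra.
Qed.

(** The cup yields a point [u] of [A] vertically above [p], the cap a point [v] below. The triangles
    over [u v] with apexes [a] and [b] lie on opposite sides of that chord and together cover a
    neighbourhood of [p]. *)
Lemma interior_between A p a b a' b' : convex_set A -> A a -> A b -> A a' -> A b' ->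
  a 0 0 < p 0 0 -> p 0 0 < b 0 0 -> a' 0 0 < p 0 0 -> p 0 0 < b' 0 0 ->
  0 < orient a p b -> orient a' p b' < 0 -> interior A p.
Proof.
move=> cA Aa Ab Aa' Ab' ap pb ap' pb' up down.
have [u Au [u0 uE]] := vertical_chord cA Aa Ab ap pb.
have [v Av [v0 vE]] := vertical_chord cA Aa' Ab' ap' pb'.
have {uE up a' b' Aa' Ab' ap' pb' down vE} [pu vp] : p 0 1 < u 0 1 /\ v 0 1 < p 0 1.
  split.
    by move: up; rewrite -uE pmulr_rgt0 ?subr_gt0// (lt_trans ap pb).
  by move: down; rewrite -vE pmulr_rlt0 ?subr_lt0// subr_gt0 (lt_trans ap' pb').
(* [tri]: near [p], points on the same side of the chord [u v] as [c] lie in the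
   triangle [c u v]. *)
have tri c (z : 'rV[R]_2) : A c -> c 0 0 != p 0 0 ->
    0 < (z 0 0 - c 0 0) / (p 0 0 - c 0 0) -> 0 <= (p 0 0 - z 0 0) / (p 0 0 - c 0 0) ->
    0 < u 0 1 - z 0 1 - (p 0 0 - z 0 0) / (p 0 0 - c 0 0) * (u 0 1 - c 0 1) ->
    0 < z 0 1 - v 0 1 - (p 0 0 - z 0 0) / (p 0 0 - c 0 0) * (c 0 1 - v 0 1) ->
    A z.
  move=> Ac cp; set s := (z 0 0 - _) / _; set t := (p 0 0 - _) / _ => s0 t0 zu vz.
  have pc : p 0 0 - c 0 0 != 0 by rewrite subr_eq0 eq_sym.
  have st : s + t = 1 by rewrite /s /t; field.
  have z0E : z 0 0 = t * c 0 0 + s * p 0 0 by rewrite /s /t; field.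
  (* The height at which the line from [c] through [z] meets the vertical line through [p]. *)
  pose y := (z 0 1 - t * c 0 1) / s.
  have sy : s * y = z 0 1 - t * c 0 1 by rewrite /y; field; lra.
  pose w : 'rV[R]_2 := \row_(i < 2) (if i == 0 then p 0 0 else y).
  have s1 : s = 1 - t by lra.
  have yu : 0 < u 0 1 - y by rewrite -(pmulr_rgt0 _ s0) mulrBr sy s1; lra.
  have vy : 0 < y - v 0 1 by rewrite -(pmulr_rgt0 _ s0) mulrBr sy s1; lra.
  have Aw : A w.
    apply: (@convex_set_weights A u v w (y - v 0 1) (u 0 1 - y)) => //; try lra.
    by apply: ord2_ind; rewrite mxE /= ?u0 ?v0; ring.
  apply: (@convex_set_weights A c w z t s) => //; try lra.
  by apply: ord2_ind; rewrite mxE /= [t + s]addrC st mul1r ?z0E ?sy; ring.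
(* The second sign condition of [tri] is not open at [p] and is left out; it comes from the side of
   [p] on which [z] lies. *)
have near_tri (c : 'rV[R]_2) : c 0 0 != p 0 0 ->
    nbhs p [set z : 'rV[R]_2 | [/\ 0 < (z 0 0 - c 0 0) / (p 0 0 - c 0 0),
      0 < u 0 1 - z 0 1 - (p 0 0 - z 0 0) / (p 0 0 - c 0 0) * (u 0 1 - c 0 1) &
      0 < z 0 1 - v 0 1 - (p 0 0 - z 0 0) / (p 0 0 - c 0 0) * (c 0 1 - v 0 1)]].
  move=> cp; have pc : p 0 0 - c 0 0 != 0 by rewrite subr_eq0 eq_sym.
  set k := (p 0 0 - c 0 0)^-1 => /=.
  have kc : k * (p 0 0 - c 0 0) = 1 by rewrite mulVf.
  near=> z; split.
  - suff : 0 < k * z 0 0 + 0 * z 0 1 + (- (k * c 0 0)) by lra.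
    by near: z; apply: near_affine_gt0; lra.
  - suff : 0 < k * (u 0 1 - c 0 1) * z 0 0 + (-1) * z 0 1 +
      (u 0 1 - k * p 0 0 * (u 0 1 - c 0 1)) by lra.
    by near: z; apply: near_affine_gt0; lra.
  - suff : 0 < k * (c 0 1 - v 0 1) * z 0 0 + 1 * z 0 1 +
      (- v 0 1 - k * p 0 0 * (c 0 1 - v 0 1)) by lra.
    by near: z; apply: near_affine_gt0; lra.
have anp : a 0 0 != p 0 0 by rewrite lt_eqF.
have bnp : b 0 0 != p 0 0 by rewrite gt_eqF.
rewrite /interior /=; near=> z.
have [|za zua zva] := near (near_tri a anp) z; first by [].
have [|zb zub zvb] := near (near_tri b bnp) z; first by [].
have [zp|pz] := leP (z 0 0) (p 0 0).
- by apply: (tri a) => //; rewrite divr_ge0// subr_ge0// ltW.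
- apply: (tri b) => //; rewrite -mulrNN -invrN divr_ge0// opprB subr_ge0//; exact: ltW.
Unshelve. all: by end_near. Qed.

End convexity.

(** * The point set: general position, convex curves, sides of a line *)

Section point_set.
Context {R : realType}.
Implicit Types (A : set 'rV[R]_2) (l : set 'rV[R]_2).

Definition points m : {fset 'rV[R]_2} := [fset pt m n | n in iota 0 (m ^ 3)]%fset.

Lemma pointsP m p : reflect (exists2 n, (n < m ^ 3)%N & p = pt m n) (p \in points m).
Proof.
apply: (iffP (imfsetP _ _ _ _)) => -[n nm ->]; exists n => //; move: nm => /=;
  by rewrite mem_iota.
Qed.

Lemma npoints_count m A :
  npoints (points m) A = count (fun n => pt m n \in A) (iota 0 (m ^ 3)).
Proof.
rewrite /npoints.
have -> : [fset x in points m | x \in A]%fset =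
    [fset pt m n | n in [seq n <- iota 0 (m ^ 3) | pt m n \in A]]%fset.
  apply/fsetP => p; rewrite !inE; apply/andP/imfsetP => /=.
    by move=> [/imfsetP[n /= nm ->] pA]; exists n; rewrite // mem_filter pA.
  move=> [n]; rewrite mem_filter => /andP[nA nm] ->; split=> //.
  by apply/imfsetP; exists n.
rewrite card_imfset /=; last exact: pt_inj.
by rewrite undup_id ?filter_uniq ?iota_uniq// size_filter.
Qed.

Lemma card_points m : #|` points m| = (m ^ 3)%N.
Proof.
by rewrite card_imfset /= ?undup_id ?iota_uniq ?size_iota//; exact: pt_inj.
Qed.

(** Permuting three points changes [orient] by at most a sign, so the increasing order suffices. *)
Lemma orient_neq0 m a b c : (0 < m)%N -> (a < m ^ 3)%N -> (b < m ^ 3)%N ->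
  (c < m ^ 3)%N -> a != b -> b != c -> a != c ->
  orient (pt m a) (pt m b) (pt m c) != 0 :> R.
Proof.
move=> m0.
have lt3 x y z : (x < y)%N -> (y < z)%N -> (z < m ^ 3)%N ->
    orient (pt m x) (pt m y) (pt m z) != 0 :> R.
  move=> xy yz z3; have := @orient_level R _ _ _ _ m0 xy yz z3.
  by case: ifP => _ h; [rewrite gt_eqF|rewrite lt_eqF].
have perms p q r : orient p q r != 0 :> R ->
    [/\ orient p r q != 0 :> R, orient q p r != 0 :> R, orient q r p != 0 :> R,
        orient r p q != 0 :> R & orient r q p != 0 :> R].
  have rot x y z : orient y z x = orient x y z :> R by rewrite /orient; ring.
  have swap x y z : orient y x z = - orient x y z :> R by rewrite /orient; ring.
  by rewrite (rot p q r) -(rot r p q) -(rot p r q) -(rot r q p) !(swap p q) oppr_eq0.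
move=> am bm cm; rewrite !neq_ltn => /orP[] ab /orP[] bc /orP[] ac; try lia.
- exact: lt3.
- by have [] := perms _ _ _ (lt3 _ _ _ ac bc bm).
- by have [] := perms _ _ _ (lt3 _ _ _ ac ab bm).
- by have [] := perms _ _ _ (lt3 _ _ _ ab ac cm).
- by have [] := perms _ _ _ (lt3 _ _ _ bc ac am).
- by have [] := perms _ _ _ (lt3 _ _ _ bc ab am).
Qed.

Lemma general_position_points m : (0 < m)%N -> general_position (points m).
Proof.
move=> m0 _ _ _ /pointsP[a a3 ->] /pointsP[b b3 ->] /pointsP[c c3 ->].
rewrite !(inj_eq (@pt_inj _ _)) => ab bc ac /collinear_orient /eqP.
exact/negP/orient_neq0.
Qed.

Lemma npoints_convex_curve m g : (0 < m)%N -> convex_curve g ->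
  (npoints (points m) g <= 8 * m)%N.
Proof.
move=> m0 [A [cptA cA _ ->]]; rewrite npoints_count -size_filter.
set s := [seq _ <- _ | _].
have s3 n : n \in s -> (n < m ^ 3)%N by rewrite mem_filter mem_iota => /andP[].
have sA n : n \in s -> A (pt m n) /\ ~ interior A (pt m n).
  rewrite mem_filter /= => /andP[/set_mem[clA nI] _]; split=> //.
  have /closure_id -> // : closed A by apply: compact_closed => //; exact: norm_hausdorff.
have ss : sorted ltn s by exact/(sorted_filter ltn_trans)/iota_ltn_sorted.
clearbody s.
pose cap n := `[< forall a b, a \in s -> b \in s -> (a < n)%N -> (n < b)%N ->
  orient (pt m a) (pt m n) (pt m b) < 0 :> R >].
pose cup n := `[< forall a b, a \in s -> b \in s -> (a < n)%N -> (n < b)%N ->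
  0 < orient (pt m a) (pt m n) (pt m b) :> R >].
(* If both fail, [n] is the middle of a cup and of a cap, zero orientation being excluded, and
   [pt m n] is interior. *)
have capcup n : n \in s -> cap n || cup n.
  move=> ns; apply/orP; apply: contrapT => /not_orP[/negP + /negP].
  move=> /asboolPn /existsNP[a /existsNP[b /not_implyP[sa /not_implyP[sb]]]].
  move=> /not_implyP[an /not_implyP[nb /negP]]; rewrite -leNgt => o1.
  move=> /asboolPn /existsNP[a' /existsNP[b' /not_implyP[sa' /not_implyP[sb']]]].
  move=> /not_implyP[an' /not_implyP[nb' /negP]]; rewrite -leNgt => o2.
  have [An []] := sA n ns.
  apply: (@interior_between _ A _ (pt m a) (pt m b) (pt m a') (pt m b')) => //;
    rewrite ?pt0 ?ltr_nat//; try by [case: (sA a sa)|case: (sA b sb)|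
      case: (sA a' sa')|case: (sA b' sb')].
  - by rewrite lt_neqAle o1 eq_sym orient_neq0 ?s3//; lia.
  - by rewrite lt_neqAle o2 orient_neq0 ?s3//; lia.
have kM P : {in seq.filter P s &, forall a b, (a < b)%N -> (key m a b < 3 * m)%N}.
  by move=> a b _; rewrite mem_filter => /andP[_ /s3 b3] _; exact: key_lt.
have ncap : (size (seq.filter cap s) <= (3 * m).+1)%N.
  apply: (@size_decreasing_chain (key m)) => //.
    exact: (sorted_filter ltn_trans).
  move=> a b c; rewrite !mem_filter => /andP[_ sa] /andP[/asboolP capb sb] /andP[_ sc].
  move=> ab bc; apply: key_decr => //; rewrite ltnNge; apply/negP => lev.
  have := @orient_level R _ _ _ _ m0 ab bc (s3 _ sc); rewrite lev.
  by have := capb a c sa sc ab bc; lra.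
have ncup : (size (seq.filter cup s) <= (3 * m).+1)%N.
  apply: (@size_increasing_chain (key m)) => //.
    exact: (sorted_filter ltn_trans).
  move=> a b c; rewrite !mem_filter => /andP[_ sa] /andP[/asboolP cupb sb] /andP[_ sc].
  move=> ab bc; apply: key_incr => //; rewrite leqNgt; apply/negP => lev.
  have := @orient_level R _ _ _ _ m0 ab bc (s3 _ sc); rewrite leqNgt lev /=.
  by have := cupb a c sa sc ab bc; lra.
have : (size s <= size (seq.filter cap s) + size (seq.filter cup s))%N.
  rewrite !size_filter -count_predUI; apply: leq_trans (leq_addr _ _).
  have : all (predU cap cup) s by apply/allP.
  by rewrite all_count => /eqP ->.
(* [2 * (3 * m + 1) <= 8 * m], as [m] is positive. *)
lia.
Qed.

Lemma line_sides m l : (0 < m)%N -> is_line l ->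
    (forall n, (n < m ^ 3)%N -> ~ l (pt m n)) ->
  exists s : nat -> bool,
    (forall a b c, (a < b)%N -> (b < c)%N -> (c < m ^ 3)%N ->
       ~~ s a -> s b -> ~~ s c -> (level m b c < level m a b)%N) /\
    (forall a b, (a < m ^ 3)%N -> (b < m ^ 3)%N -> s a = s b ->
       forall t : R, 0 <= t -> t <= 1 -> ~ l (pt m a + t *: (pt m b - pt m a))).
Proof.
move=> m0 [u [v [d [uv ->]]]] avoid.
pose f (p : 'rV[R]_2) := u * p 0 0 + v * p 0 1 - d.
have fN0 n : (n < m ^ 3)%N -> f (pt m n) != 0.
  by move=> nm; rewrite /f subr_eq0; apply/eqP/(avoid n nm).
(* As [f] is affine, the terms in [u] and [d] cancel, and only the heights contribute. *)
have fE a b c : (b%:R - a%:R) * f (pt m c) + (c%:R - b%:R) * f (pt m a) -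
    (c%:R - a%:R) * f (pt m b) = v * orient (pt m a) (pt m b) (pt m c).
  by rewrite /f /orient !pt0; ring.
(* Above the line, or on a fixed side of it when it is vertical. *)
exists (fun n => if v < 0 then f (pt m n) < 0 else 0 < f (pt m n)); split.
- move=> a b c ab bc c3 sa sb sc; rewrite ltnNge; apply/negP => lev.
  have := @orient_level R _ _ _ _ m0 ab bc c3; rewrite lev => o0.
  have {fE} := fE a b c.
  have : 0 < b%:R - a%:R :> R by rewrite subr_gt0 ltr_nat.
  have : 0 < c%:R - b%:R :> R by rewrite subr_gt0 ltr_nat.
  have -> : c%:R - a%:R = (b%:R - a%:R) + (c%:R - b%:R) :> R by ring.
  move: sa sb sc; move: (b%:R - a%:R) (c%:R - b%:R) => g1 g2.
  case: ltP => v0; rewrite -!leNgt => sa sb sc g2_gt0 g1_gt0.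
  + have : 0 <= g1 * f (pt m c) by rewrite mulr_ge0// ltW.
    have : 0 <= g2 * f (pt m a) by rewrite mulr_ge0// ltW.
    have : (g1 + g2) * f (pt m b) < 0 by rewrite pmulr_rlt0// addr_gt0.
    have : v * orient (pt m a) (pt m b) (pt m c) < 0 by rewrite nmulr_rlt0.
    lra.
  + have : g1 * f (pt m c) <= 0 by rewrite pmulr_rle0.
    have : g2 * f (pt m a) <= 0 by rewrite pmulr_rle0.
    have : 0 < (g1 + g2) * f (pt m b) by rewrite pmulr_rgt0// addr_gt0.
    have : 0 <= v * orient (pt m a) (pt m b) (pt m c) by rewrite mulr_ge0// ltW.
    lra.
- move=> a b a3 b3 sab t t0 t1 /=.
  have : (0 < f (pt m a)) = (0 < f (pt m b)).
    move: sab; case: ifP => // _.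
    have pos n : (n < m ^ 3)%N -> (0 < f (pt m n)) = ~~ (f (pt m n) < 0).
      by move=> nm; rewrite lt_neqAle eq_sym fN0// leNgt.
    by rewrite !pos// => ->.
  move=> fab fd.
  (* A convex combination of two nonzero values of equal sign cannot vanish. *)
  have : (1 - t) * f (pt m a) + t * f (pt m b) = 0.
    by rewrite -[RHS](subrr d) -{1}fd /f !mxE; ring.
  have := fN0 a a3; have := fN0 b b3; rewrite !neq_lt.
  move: (f (pt m a)) (f (pt m b)) fab => x y fab /orP[y0|y0] /orP[x0|x0].
  - by have [?|?] := eqVneq t 0; nra.
  - by move: y0; rewrite ltNge ltW// -fab.
  - by move: x0; rewrite ltNge ltW// fab.
  - by have [?|?] := eqVneq t 0; nra.
Qed.

End point_set.

(** * Simple arrangements and the cutting number *)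

Section cutting.
Context {R : realType}.
Implicit Types (X : {fset 'rV[R]_2}) (L : set (set 'rV[R]_2)).

(** The tangent to the parabola [y = x ^ 2] at abscissa [t]. Two tangents meet above the mean of
    their abscissae, or below it, so no three are concurrent. *)
Definition parabola_tangent (t : R) : set 'rV[R]_2 :=
  [set q | 2 * t * q 0 0 + (-1) * q 0 1 = t ^+ 2].

Lemma parabola_tangentI (s t : R) (q : 'rV[R]_2) : s != t ->
  parabola_tangent s q -> parabola_tangent t q -> 2 * q 0 0 = s + t.
Proof.
rewrite /parabola_tangent /= -subr_eq0 => st es et.
by apply: (mulfI st); rewrite -subr_sqr -es -et; ring.
Qed.

Lemma parabola_tangent_inj : injective parabola_tangent.
Proof.
move=> s t est; apply/eqP; apply: contrapT => /negP st.
pose q : 'rV[R]_2 := \row_(i < 2) (if i == 0 then s else s ^+ 2).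
have qs : parabola_tangent s q by rewrite /parabola_tangent /= !mxE /=; ring.
have qt : parabola_tangent t q by rewrite -est.
have := parabola_tangentI st qs qt; rewrite !mxE /= => e.
by move/eqP : st; apply; lra.
Qed.

Lemma simple_arrangement_tangents K (T : R) :
  simple_arrangement K ((fun i => parabola_tangent (T + i%:R)) @` `I_K).
Proof.
have neq i j : parabola_tangent (T + i%:R) <> parabola_tangent (T + j%:R) ->
    T + i%:R != T + j%:R by move=> ij; apply/eqP => e; apply: ij; rewrite e.
split.
- apply: inj_card_eq => i j _ _ /parabola_tangent_inj /addrI /eqP.
  by rewrite eqr_nat => /eqP.
- move=> _ [i _ <-]; exists (2 * (T + i%:R)), (-1), ((T + i%:R) ^+ 2).
  by split=> //; right; rewrite oppr_eq0 oner_eq0.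
- move=> _ _ [i _ <-] [j _ <-] ij [//|] /seteqP[+ _].
  set s := T + i%:R; set t := T + j%:R.
  move=> /(_ (\row_(k < 2) (if k == 0 then (s + t) / 2 else s * t))); apply.
  by split; rewrite /parabola_tangent /= !mxE /=; field.
- move=> _ _ _ [i _ <-] [j _ <-] [k _ <-] /neq ij /neq jk /neq ik.
  rewrite -subset0 => q [[qi qj] qk].
  have := parabola_tangentI ij qi qj; have := parabola_tangentI jk qj qk => e1 e2.
  by move/eqP : ik; apply; lra.
Qed.

(** A lower bound valid for each arrangement passes to the infimum [CUT] once the family is
    nonempty. *)
Lemma ex_simple_arrangement K X : exists L, simple_arrangement K L /\ avoids L X.
Proof.
pose B : R := \sum_(p <- X) (2 * `|p 0 0| + `|p 0 1|).
have F0 (p : 'rV[R]_2) : 0 <= 2 * `|p 0 0| + `|p 0 1|.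
  by rewrite addr_ge0// mulr_ge0.
have BX p : p \in X -> 2 * `|p 0 0| + `|p 0 1| <= B.
  by move=> pX; rewrite /B (bigD1_seq p) ?fset_uniq//= lerDl sumr_ge0.
have B0 : 0 <= B by exact: sumr_ge0.
(* A tangent of large slope passes below every point of [X]. *)
exists ((fun i => parabola_tangent (B + 1 + i%:R)) @` `I_K).
split; first exact: simple_arrangement_tangents.
move=> p /BX pB [_ [i _ <-]] /=; rewrite /parabola_tangent /=.
have : 0 <= i%:R :> R by [].
move: i%:R => n n0 e.
have tB : B + 1 <= B + 1 + n by lra.
move: (B + 1 + n) tB e => t tB e.
have : 2 * t * p 0 0 <= 2 * t * `|p 0 0| by rewrite ler_wpM2l ?ler_norm//; lra.
have : - p 0 1 <= `|p 0 1| by rewrite -normrN ler_norm.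
have := normr_ge0 (p 0 0); have := normr_ge0 (p 0 1).
(* As [1 <= t], [2 * t * x + y <= t * (2 * x + y) <= t * (t - 1) < t ^ 2], contradicting [e]. *)
move: `|p 0 0| `|p 0 1| pB => x y pB; nra.
Qed.

Lemma segment_component (C : set 'rV[R]_2) p q :
  (forall t : R, 0 <= t -> t <= 1 -> C (p + t *: (q - p))) ->
  connected_component C p q.
Proof.
move=> sC.
have := @connected_component_max _ C ((fun t : R => p + t *: (q - p)) @` `[0, 1]) p.
apply.
- by exists 0; rewrite /= ?in_itv/= ?lexx ?ler01// scale0r addr0.
- by move=> x [t /=]; rewrite in_itv/= => /andP[t0 t1] <-; exact: sC.
- apply: connected_continuous_connected; first exact: segment_connected.
  apply: continuous_subspaceT => t; apply: cvgD; first exact: cvg_cst.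
  by apply: cvgZr_tmp; exact: cvg_id.
- by exists 1; rewrite /= ?in_itv/= ?lexx ?ler01// scale1r addrC subrK.
Qed.

Lemma max_cell_ge (X : {fset 'rV[R]_2}) L p : arrangement_complement L p ->
  (npoints X (connected_component (arrangement_complement L) p))%:R <= max_cell X L.
Proof.
move=> Lp; apply: ub_le_sup; last first.
  by exists (connected_component (arrangement_complement L) p) => //; exists p.
exists (#|` X|)%:R => _ [A _ <-]; rewrite ler_nat.
by apply: fsubset_leq_card; apply/fsubsetP => x; rewrite !inE => /andP[].
Qed.

Lemma max_cell_points m K L : (0 < m)%N -> (0 < K)%N -> simple_arrangement K L ->
  avoids L (points m) -> 9^-1 * ((m ^ 3)%:R / K%:R) <= max_cell (points m) L.
Proof.
move=> m0 K0 [LK Llines _ _] LX.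
have [l Ll lL] : exists2 l : nat -> set 'rV[R]_2,
    forall i, (i < K)%N -> L (l i) & forall A, L A -> exists2 i, (i < K)%N & l i = A.
  move: LK; rewrite card_eq_sym => /pcard_eqP[f]; exists f.
    by move=> i iK; exact: funS.
  by move=> A /(@surj _ _ _ _ f)[i iK <-]; exists i.
have avoid i n : (i < K)%N -> (n < m ^ 3)%N -> ~ l i (pt m n).
  move=> iK nm li; apply: (LX (pt m n)); first by apply/pointsP; exists n.
  by exists (l i) => //; exact: Ll.
have /choice[S SP] : forall i, exists s : nat -> bool, (i < K)%N ->
    (forall a b c, (a < b)%N -> (b < c)%N -> (c < m ^ 3)%N ->
       ~~ s a -> s b -> ~~ s c -> (level m b c < level m a b)%N) /\
    (forall a b, (a < m ^ 3)%N -> (b < m ^ 3)%N -> s a = s b ->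
       forall t : R, 0 <= t -> t <= 1 -> ~ l i (pt m a + t *: (pt m b - pt m a))).
  move=> i; case: (ltnP i K) => iK; last by exists xpredT; lia.
  have [s sP] := line_sides m0 (Llines _ (Ll i iK)) (fun n => @avoid i n iK).
  by exists s.
pose changes i n := count (fun c => S i c != S i c.+1) (iota 0 n).
(* Side changes before [n], summed over all lines: nondecreasing in [n], so its fibres are the
   blocks of consecutive points. *)
pose block n := (\sum_(i < K) changes i n)%N.
have changes_mono i a b : (a <= b)%N -> (changes i a <= changes i b)%N.
  by move=> ab; rewrite /changes -(subnKC ab) iotaD count_cat leq_addr.
have block_lt n : (n < m ^ 3)%N -> (block n < (8 * K).+1)%N.
  move=> nm; rewrite ltnS mulnC -[X in (_ <= X * _)%N]card_ord -sum_nat_const.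
  apply: leq_sum => i _; apply: (@count_sign_changes m (m ^ 3)) => //.
  by have [] := SP i (ltn_ord i).
have same_side i a b : (i < K)%N -> block a = block b -> S i a = S i b.
  wlog ab : a b / (a <= b)%N.
    move=> wl iK ab; have [|/ltnW] := leqP a b => ?; first exact: wl.
    by apply/esym/wl.
  move=> iK blab; apply: sign_change_free => //.
  (* Equal sums of termwise ordered terms have equal terms, so no line changes side between [a] and
     [b]. *)
  have /leqifP := leqif_sum (fun (i : 'I_K) (_ : true) => leqif_eq (changes_mono i a b ab)).
  rewrite -/(block a) -/(block b) blab ltnn; case: ifP => // /forallP h _.
  exact/eqP/(h (Ordinal iK)).
have [v Nv] := pigeonhole_count (ltn0Sn (8 * K)) block_lt.
have : (0 < count (fun n => block n == v) (iota 0 (m ^ 3)))%N.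
  rewrite lt0n; apply/eqP => e; move: Nv; rewrite e muln0 leqn0 expn_eq0 andbT; lia.
rewrite -has_count => /hasP[n0 +  /eqP n0v]; rewrite mem_iota => /= n0m.
have n0C : arrangement_complement L (pt m n0).
  by apply: LX; apply/pointsP; exists n0.
apply: le_trans (max_cell_ge _ n0C).
rewrite mulrA ler_pdivrMr ?ltr0n// mulrC ler_pdivrMr ?ltr0n// -!natrM ler_nat.
apply: (leq_trans Nv); rewrite npoints_count.
set u := count _ _; set w := count _ _.
have uw : (u <= w)%N.
  rewrite /u /w -!size_filter; apply: uniq_leq_size; first by rewrite filter_uniq ?iota_uniq.
  move=> n; rewrite !mem_filter => /andP[/eqP nv nm]; rewrite nm andbT.
  apply/mem_set/segment_component => t t0 t1 [A /lL[i iK <-]].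
  have [_] := SP i iK; apply=> //; first by move: nm; rewrite mem_iota.
  by apply: same_side; rewrite // nv.
(* The constant 9 comes from [8 * K + 1 <= 9 * K]. *)
by rewrite mulnAC; nia.
Qed.

End cutting.

Theorem theorem3p2 (R : realType) :
  exists (c C : R) (X : nat -> {fset 'rV[R]_2}),
    [/\ 0 < c,
        0 < C,
        forall j : nat, general_position (X j),
        (fun j : nat => #|` X j|) @ \oo --> \oo &
        forall j : nat,
          CON (X j) <= C * (#|` X j|%:R : R) `^ (3^-1) /\
          forall K : nat, (1 <= K)%N ->
            c * (#|` X j|%:R / K%:R) <= CUT K (X j)].
Proof.
(* The shift to [j.+1] keeps the base of the digits positive. *)
exists 9^-1, 8, (fun j => points j.+1); split=> //.
- by move=> j; exact: general_position_points.
- apply/cvgnyPge => A; near=> j; rewrite card_points.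
  have : (A <= j)%N by near: j; exact: nbhs_infty_ge.
  by move=> Aj; rewrite (leq_trans Aj)// (leq_trans (leqnSn j))// -{1}[j.+1]expn1 leq_pexp2l.
- move=> j; rewrite card_points; split; last first.
    move=> K K0; apply: lb_le_inf.
      have [L LP] := ex_simple_arrangement K (@points R j.+1).
      by exists (max_cell (points j.+1) L), L.
    by move=> _ [L [LK LX] <-]; exact: max_cell_points.
  rewrite natrX -powR_mulrn// -powRrM mulfV// powRr1//.
  have bound g : convex_curve g -> (npoints (@points R j.+1) g)%:R <= 8 * j.+1%:R :> R.
    by move=> gc; rewrite -natrM ler_nat npoints_convex_curve.
  rewrite /CON; set E := (X in sup X).
  (* The supremum of the empty set is 0, so the bound holds in either case. *)
  have [E0|/set0P/negP/negPn/eqP ->] := pselect (E !=set0).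
    by apply: ge_sup => // _ [g gc <-]; exact: bound.
  by rewrite sup0 mulr_ge0.
Unshelve. all: by end_near. Qed.
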